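(* Let $(\widetilde{\mathfrak g},H_0)$ be a regular graded Lie algebra over $F$, let $I^+$ be a generic element of $V^+$ and let $I^-\in V^-$ be such that $(I^-,H_0,I^+)$ is an $\mathfrak{sl}_2$-triple. Let $w=e^{\operatorname{ad}I^+}e^{\operatorname{ad}I^-}e^{\operatorname{ad}I^+}$ and let $\sigma$ be the automorphism $\sigma(X)=w.X$ of $\widetilde{\mathfrak g}$. Then $\sigma$ is an involution of $\widetilde{\mathfrak g}$ with the following properties. (1) Let $\mathfrak h=\{X\in\mathfrak g:\sigma(X)=X\}$. Then $\mathfrak h=\mathfrak z_{\mathfrak g}(I^+)=\mathfrak z_{\mathfrak g}(I^-)$. (2) Let $\mathfrak q=\{X\in\mathfrak g:\sigma(X)=-X\}$. Then $\operatorname{ad}I^+$ is an isomorphism from $\mathfrak q$ onto $V^+$ and $\operatorname{ad}I^-$ is an isomorphism from $\mathfrak q$ onto $V^-$. (3) $\sigma(I^+)=I^-$ and $\sigma(V^+)=V^-$. Moreover $\sigma(X)=\frac12(\operatorname{ad}I^-)^2X$ for $X\in V^+$ and $\sigma(X)=\frac12(\operatorname{ad}I^+)^2X$ for $X\in V^-$. (4) $\sigma(H_0)=-H_0$ and $\sigma(\mathfrak g)=\mathfrak g$. Moreover, $\sigma(X)=X+(\operatorname{ad}I^-\operatorname{ad}I^+)X$ for $X\in\mathfrak g$.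
   Context: $F$ is a finite extension of $\mathbb Q_p$ whose residue field has characteristic $\neq 2$; $\overline F$ is an algebraic closure and $\overline U=U\otimes_F\overline F$. A regular graded Lie algebra is a reductive Lie algebra $\widetilde{\mathfrak g}$ over $F$ with an element $H_0$ such that (H1) $\widetilde{\mathfrak g}=V^-\oplus\mathfrak g\oplus V^+$ with $V^+\ne 0$, where $V^-,\mathfrak g,V^+$ are the eigenspaces of $\operatorname{ad}H_0$ for the eigenvalues $-2,0,2$; (H2) the bracket representation of $\mathfrak g$ on $\overline{V^+}$ is irreducible; (H3) there are elements of $V^-$ and $V^+$ forming with $H_0$ an $\mathfrak{sl}_2$-triple. Convention: $(Y,H,X)$ is an $\mathfrak{sl}_2$-triple if $[H,X]=2X$, $[H,Y]=-2Y$, $[Y,X]=H$. $X\in V^+$ is generic if $\operatorname{ad}X:\mathfrak g\to V^+$ is surjective; for such $X$ there is a unique $Y\in V^-$ with $(Y,H_0,X)$ an $\mathfrak{sl}_2$-triple. $\mathfrak z_{\mathfrak g}(Z)$ denotes the centralizer of $Z$ in $\mathfrak g$. *)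

(* Defs.v *)
From HB Require Import structures.
From mathcomp Require Import all_boot all_order all_algebra all_field.
From mathcomp Require Import boolp.

Set Implicit Arguments.
Unset Strict Implicit.
Unset Printing Implicit Defensive.

Import Order.TTheory GRing.Theory Num.Theory.
Local Open Scope ring_scope.

(* The p-adic integers as the inverse limit of the rings Z/p^n: a sequence x  *)
(* with x n the representative in [0, p^n) of the n-th component.  The        *)
(* equation below forces both the range of x n and x (n+1) = x n mod p^n.     *)

Definition padic_coherent (p : nat) (x : nat -> int) : bool :=
  `[< forall n, x n = (x n.+1 %% (p ^ n)%N)%Z >].

Record padic_int (p : nat) (p_pr : prime p) := PadicInt {
  padic_coord : nat -> int;
  _ : padic_coherent p padic_coord
}.
Arguments padic_coord {p p_pr} _ _.

HB.instance Definition _ (p : nat) (p_pr : prime p) :=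
  [isSub for @padic_coord p p_pr].
HB.instance Definition _ (p : nat) (p_pr : prime p) :=
  [Choice of padic_int p_pr by <:].

Section PadicIntegers.
Variables (p : nat) (p_pr : prime p).
Implicit Types (f g : nat -> int) (x y z : padic_int p_pr).

Let pn_gt0 n : (0 < p ^ n)%N.
Proof. by rewrite expn_gt0 prime_gt0. Qed.

Lemma padic_coordP x n : padic_coord x n = (padic_coord x n.+1 %% (p ^ n)%N)%Z.
Proof. by move/asboolP: (valP x); apply. Qed.

Lemma padic_coord_mod x n : (padic_coord x n %% (p ^ n)%N)%Z = padic_coord x n.
Proof. by rewrite padic_coordP modz_mod. Qed.

Lemma modz_dvdm (a d e : int) : (e %| d)%Z -> ((a %% d)%Z = a %[mod e])%Z.
Proof.
move=> ed; apply/eqP; rewrite eqz_mod_dvd [X in _ - X](divz_eq a d).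
by rewrite opprD addrCA subrr addr0 rpredN dvdz_mull.
Qed.

Lemma modz_pSn (a : int) n :
  ((a %% (p ^ n.+1)%N)%Z = a %[mod (p ^ n)%N])%Z.
Proof. by rewrite modz_dvdm // dvdzE /= expnS dvdn_mull. Qed.

Lemma padic_coordD x n k : (padic_coord x (n + k) %% (p ^ n)%N)%Z = padic_coord x n.
Proof.
elim: k => [|k IH]; first by rewrite addn0 padic_coord_mod.
rewrite -[RHS]IH addnS [padic_coord x (n + k)]padic_coordP modz_dvdm //.
by rewrite dvdzE /= expnD dvdn_mulr.
Qed.

Definition is_tower f :=
  forall n, (f n.+1 = f n %[mod (p ^ n)%N])%Z.

Lemma padic_mk_subproof f (fP : is_tower f) :
  padic_coherent p (fun n => (f n %% (p ^ n)%N)%Z).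
Proof. by apply/asboolP => n; rewrite modz_pSn. Qed.

Definition padic_mk f (fP : is_tower f) : padic_int p_pr :=
  PadicInt p_pr (padic_mk_subproof fP).

Lemma padic_mkE f (fP : is_tower f) n :
  padic_coord (padic_mk fP) n = (f n %% (p ^ n)%N)%Z.
Proof. by []. Qed.

Lemma padic_eqP x y : (forall n, padic_coord x n = padic_coord y n) -> x = y.
Proof. by move=> h; apply: val_inj; apply/funext. Qed.

Lemma padic_eqmod x n : (padic_coord x n.+1 = padic_coord x n %[mod (p ^ n)%N])%Z.
Proof. by rewrite padic_coord_mod -padic_coordP. Qed.

Lemma padic_const_subproof (a : int) : is_tower (fun=> a).
Proof. by []. Qed.

Lemma padic_opp_subproof x : is_tower (fun n => - padic_coord x n).
Proof.
by move=> n; apply/eqP; rewrite -modzNm padic_eqmod modzNm.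
Qed.

Lemma padic_add_subproof x y : is_tower (fun n => padic_coord x n + padic_coord y n).
Proof.
by move=> n; rewrite -modzDm !padic_eqmod modzDm.
Qed.

Lemma padic_mul_subproof x y : is_tower (fun n => padic_coord x n * padic_coord y n).
Proof.
by move=> n; rewrite -modzMm !padic_eqmod modzMm.
Qed.

Definition padic_zero : padic_int p_pr := padic_mk (padic_const_subproof 0).
Definition padic_one : padic_int p_pr := padic_mk (padic_const_subproof 1).
Definition padic_opp x : padic_int p_pr := padic_mk (padic_opp_subproof x).
Definition padic_add x y : padic_int p_pr := padic_mk (padic_add_subproof x y).
Definition padic_mul x y : padic_int p_pr := padic_mk (padic_mul_subproof x y).

Lemma padic_addA : associative padic_add.
Proof. by move=> x y z; apply: padic_eqP => n; rewrite !padic_mkE modzDml modzDmr addrA. Qed.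

Lemma padic_addC : commutative padic_add.
Proof. by move=> x y; apply: padic_eqP => n; rewrite !padic_mkE addrC. Qed.

Lemma padic_add0 : left_id padic_zero padic_add.
Proof.
by move=> x; apply: padic_eqP => n; rewrite !padic_mkE modzDml add0r padic_coord_mod.
Qed.

Lemma padic_addN : left_inverse padic_zero padic_opp padic_add.
Proof. by move=> x; apply: padic_eqP => n; rewrite !padic_mkE modzDml addNr. Qed.

HB.instance Definition _ :=
  GRing.isZmodule.Build (padic_int p_pr) padic_addA padic_addC padic_add0 padic_addN.

Lemma padic_mulA : associative padic_mul.
Proof. by move=> x y z; apply: padic_eqP => n; rewrite !padic_mkE modzMml modzMmr mulrA. Qed.

Lemma padic_mulC : commutative padic_mul.
Proof. by move=> x y; apply: padic_eqP => n; rewrite !padic_mkE mulrC. Qed.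

Lemma padic_mul1 : left_id padic_one padic_mul.
Proof.
by move=> x; apply: padic_eqP => n; rewrite !padic_mkE modzMml mul1r padic_coord_mod.
Qed.

Lemma padic_mulDl : left_distributive padic_mul padic_add.
Proof.
by move=> x y z; apply: padic_eqP => n; rewrite !padic_mkE modzMml mulrDl modzDm.
Qed.

Lemma padic_one_neq0 : padic_one != 0.
Proof.
apply/eqP => /(congr1 (fun x => padic_coord x 1)).
by rewrite !padic_mkE expn1 mod0z modz_small //= ltz_nat prime_gt1.
Qed.

HB.instance Definition _ := GRing.Zmodule_isComNzRing.Build (padic_int p_pr)
  padic_mulA padic_mulC padic_mul1 padic_mulDl padic_one_neq0.

Definition padic_unit x : bool := `[< exists y, y * x = 1 >].
Definition padic_inv x : padic_int p_pr :=
  if pselect (exists y, y * x = 1) is left h then sval (cid h) else x.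

Lemma padic_mulV : {in padic_unit, left_inverse 1 padic_inv *%R}.
Proof.
move=> x /asboolP xU; rewrite /padic_inv.
by case: pselect => // h; case: cid.
Qed.

Lemma padic_unitPl x y : y * x = 1 -> padic_unit x.
Proof. by move=> h; apply/asboolP; exists y. Qed.

Lemma padic_inv_out : {in [predC padic_unit], padic_inv =1 id}.
Proof. by move=> x /asboolPn xNU; rewrite /padic_inv; case: pselect. Qed.

HB.instance Definition _ := GRing.ComNzRing_hasMulInverse.Build (padic_int p_pr)
  padic_mulV padic_unitPl padic_inv_out.

Lemma padic_neq0 x : x != 0 -> exists n, padic_coord x n != 0.
Proof.
move=> x0; apply: contrapT => h; case/eqP: x0.
apply: padic_eqP => n; rewrite padic_mkE mod0z.
by apply/eqP; apply: contrapT => hn; apply: h; exists n; apply/negP.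
Qed.

Lemma padic_mulf_eq0 : GRing.integral_domain_axiom (padic_int p_pr).
Proof.
move=> x y xy0; case: eqVneq => //= x0; apply: contrapT => /negP y0.
have [n xn] := padic_neq0 x0; have [m ym] := padic_neq0 y0.
have lo (z : padic_int p_pr) k l : padic_coord z k != 0 ->
    (`|padic_coord z (k + l)| > 0)%N /\ (logn p `|padic_coord z (k + l)| < k)%N.
  rewrite -(padic_coordD z k l) => zk.
  have z0 : padic_coord z (k + l) != 0.
    by apply: contraNneq zk => ->; rewrite mod0z.
  split; first by rewrite absz_gt0.
  rewrite ltnNge; apply: contra zk => le_k.
  apply/eqP/dvdz_mod0P; rewrite dvdzE /= -(pfactor_dvdn _ p_pr) // in le_k *.
  by rewrite absz_gt0.
have [x1 x2] := lo x n m xn; have [y1 y2] := lo y m n ym.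
rewrite addnC in y1 y2.
have := congr1 (fun z => padic_coord z (n + m)) xy0.
rewrite !padic_mkE mod0z => /dvdz_mod0P; rewrite dvdzE /= abszM.
rewrite pfactor_dvdn ?muln_gt0 ?x1 // lognM // leqNgt => /negP; apply.
by apply: leq_trans (leq_add x2 (ltnW y2)); rewrite addSn.
Qed.

HB.instance Definition _ :=
  GRing.ComUnitRing_isIntegral.Build (padic_int p_pr) padic_mulf_eq0.

End PadicIntegers.

Definition Qp (p : nat) (p_pr : prime p) := {fraction padic_int p_pr}.
HB.instance Definition _ (p : nat) (p_pr : prime p) :=
  GRing.Field.on (Qp p_pr).

Section ResidueField.
Variables (p : nat) (p_pr : prime p) (F : fieldExtType (Qp p_pr)).

Definition padic_int_to_ext (a : padic_int p_pr) : F :=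
  (@tofrac (padic_int p_pr) a : Qp p_pr)%:A.

(* The valuation ring of F is the integral closure of the p-adic integers;    *)
(* its maximal ideal consists of its non-units.                               *)
Definition valuation_ring (x : F) : Prop := integralOver padic_int_to_ext x.

Definition valuation_ideal (x : F) : Prop :=
  valuation_ring x /\ ~ (exists2 y, valuation_ring y & x * y = 1).

(* l \in [pchar k], unfolded, for k the quotient valuation_ring by            *)
(* valuation_ideal.                                                           *)
Definition residue_pchar (l : nat) : Prop :=
  prime l /\ valuation_ideal l%:R.

End ResidueField.

Definition algebraic_closure (F : fieldType) (Fbar : closedFieldType)
  (iota : {rmorphism F -> Fbar}) : Prop :=
  forall x : Fbar, algebraicOver iota x.

HB.mixin Record Vector_isLie (F : fieldType) L of Vector F L := {
  lie_bracket : L -> L -> L;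
  lie_bracket_linearl : forall y, linear (lie_bracket^~ y);
  lie_bracket_linearr : forall x, linear (lie_bracket x);
  lie_bracket_alternating : forall x, lie_bracket x x = 0;
  lie_bracket_jacobi : forall x y z,
    lie_bracket x (lie_bracket y z) + lie_bracket y (lie_bracket z x)
      + lie_bracket z (lie_bracket x y) = 0
}.

#[short(type="lieAlgType")]
HB.structure Definition LieAlgebra (F : fieldType) :=
  {L of Vector_isLie F L & Vector F L}.

Notation "[lie x , y ]" := (lie_bracket x y)
  (at level 0, x, y at level 99, format "[lie  x ,  y ]").

Section LieAlgebras.
Variables (F : fieldType) (L : lieAlgType F).
Implicit Types (X Y H : L) (U W : {vspace L}).

HB.instance Definition _ X :=
  GRing.isLinear.Build F L L *:%R (lie_bracket X) (lie_bracket_linearr X).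

Definition ad X : 'End(L) := linfun (lie_bracket X).

Definition lie_ideal U : Prop := forall X Y, Y \in U -> [lie X, Y] \in U.

(* Reductive: the adjoint representation is completely reducible.             *)
Definition reductive : Prop :=
  forall U, lie_ideal U ->
    exists2 W, lie_ideal W & (U + W = fullv)%VS /\ (U :&: W = 0)%VS.

Definition sl2_triple Y H X : Prop :=
  [/\ [lie H, X] = 2%:R *: X, [lie H, Y] = - 2%:R *: Y & [lie Y, X] = H].

Definition centralizer U X : {vspace L} := (U :&: lker (ad X))%VS.

(* The exponential of a nilpotent endomorphism f of L: the omitted terms, of  *)
(* degree > \dim L, vanish.                                                   *)
Definition lfun_exp (f : 'End(L)) : 'End(L) :=
  \sum_(k < (\dim {:L}).+1)
    (k`!%:R : F)^-1 *: iter k (fun g => (f \o g)%VF) \1%VF.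

Definition lie_automorphism (s : 'End(L)) : Prop :=
  bijective s /\ forall X Y, s [lie X, Y] = [lie s X, s Y].

Definition lie_involution (s : 'End(L)) : Prop :=
  [/\ lie_automorphism s, (s \o s = \1)%VF & s <> \1%VF].

Definition iso_onto (f : 'End(L)) U W : Prop :=
  {in U &, injective f} /\ (f @: U)%VS = W.

Variable H0 : L.

Definition gr_minus : {vspace L} := passmx.leigenspace (ad H0) (- 2%:R).
Definition gr_zero : {vspace L} := passmx.leigenspace (ad H0) 0.
Definition gr_plus : {vspace L} := passmx.leigenspace (ad H0) 2%:R.

Definition generic X : Prop :=
  X \in gr_plus /\ (ad X @: gr_zero)%VS = gr_plus.

(* Matrix, acting on row vectors, of f restricted to U in the basis vbasis U  *)
(* (meaningful when f stabilizes U).                                          *)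
Definition restr_mx U (f : 'End(L)) : 'M[F]_(\dim U) :=
  \matrix_(i, j) coord (vbasis U) j (f (vbasis U)`_i).

(* U (x) Fbar, identified with 'rV[Fbar]_(\dim U) via vbasis U, is an         *)
(* irreducible representation of W acting by brackets; subspaces of           *)
(* U (x) Fbar are row spaces of square matrices.                              *)
Definition geom_irreducible (Fbar : closedFieldType)
    (iota : {rmorphism F -> Fbar}) W U : Prop :=
  (0 < \dim U)%N /\
  forall M : 'M[Fbar]_(\dim U),
    (forall X, X \in W -> stablemx M (map_mx iota (restr_mx U (ad X)))) ->
    M = 0 \/ row_full M.

Record regular_graded (Fbar : closedFieldType)
    (iota : {rmorphism F -> Fbar}) : Prop := RegularGraded {
  rg_reductive : reductive;
  rg_sum : (gr_minus + gr_zero + gr_plus)%VS = fullv;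
  rg_direct : directv (gr_minus + gr_zero + gr_plus);
  rg_plus_neq0 : gr_plus != 0%VS;
  rg_irreducible : geom_irreducible iota gr_zero gr_plus;
  rg_regular : exists Y X,
    [/\ Y \in gr_minus, X \in gr_plus & sl2_triple Y H0 X]
}.

End LieAlgebras.

(* Main.v *)
(* Put e = ad I^+ and f = ad I^-.  Since (ad H0)^3 = 4 ad H0, the eigenvalues
   4 and -4 do not occur, so e^3 = f^3 = 0, e kills V^+ and f kills V^-.
   Moreover [f, e] = ad H0 gives ef = -2 on V^+, fe = -2 on V^- and ef = fe on
   g, from which the three closed formulas for sigma on V^+, V^- and g follow
   by expanding exp e = 1 + e + e^2/2 and exp f = 1 + f + f^2/2.  On g, efe = -2e and
   fef = -2f, so fe is annihilated by t(t + 2), with kernel the centralizer of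
   I^+ (and of I^-) and with -2-eigenspace the anti-fixed space q, on which e
   and f are inverted by -f/2 and -e/2. *)

Require Import Defs.
From HB Require Import structures.
From mathcomp Require Import all_boot all_order all_algebra all_field.
From mathcomp Require Import boolp ring.

Import GRing.Theory.
Local Open Scope ring_scope.

(** * Characteristic zero of [F] *)

Lemma padic_int_natr_eq0 (p : nat) (p_pr : prime p) (n : nat) :
  (n%:R == 0 :> padic_int p_pr) = (n == 0%N).
Proof.
have coordn m k :
    padic_coord (m%:R : padic_int p_pr) k = (m%:Z %% (p ^ k)%N)%Z.
  elim: m => [|m IH]; first by rewrite padic_mkE.
  by rewrite -addn1 natrD PoszD -modzDm -IH.
(* The coordinate of index [n] suffices: since [n < p ^ n], reduction modulo [p ^ n] leaves [n]
   unchanged. *)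
apply/eqP/eqP => [n0|->//]; have := coordn n n.
rewrite n0 (coordn 0%N) mod0z modz_small; first by case.
by rewrite ltz_nat ltn_expl ?prime_gt1.
Qed.

Lemma padic_ext_natr_eq0 (p : nat) (p_pr : prime p)
  (F : fieldExtType (Qp p_pr)) (n : nat) : (n%:R == 0 :> F) = (n == 0%N).
Proof.
have <- : (n%:R : Qp p_pr)%:A = n%:R :> F by rewrite scaler_nat.
rewrite scaler_eq0 oner_eq0 orbF -(padic_int_natr_eq0 p p_pr).
by rewrite -[RHS]tofrac_eq rmorph_nat rmorph0.
Qed.

Section LieAlgebras.
Context {F : fieldType} {L : lieAlgType F}.
Implicit Types X Y Z H : L.

(** * Bracket calculus *)

Lemma lieDl X Y Z : [lie X + Y, Z] = [lie X, Z] + [lie Y, Z].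
Proof. by rewrite -[X in LHS]scale1r lie_bracket_linearl scale1r. Qed.

Lemma lieC X Y : [lie X, Y] = - [lie Y, X].
Proof.
apply/eqP; rewrite -addr_eq0; apply/eqP.
rewrite -[RHS](lie_bracket_alternating (X + Y)) lieDl !linearD /=.
by rewrite !lie_bracket_alternating add0r addr0.
Qed.

Lemma lieZl a X Y : [lie a *: X, Y] = a *: [lie X, Y].
Proof. by rewrite [LHS]lieC linearZ [in RHS]lieC scalerN. Qed.

Lemma lieDr X Y Z : [lie X, Y + Z] = [lie X, Y] + [lie X, Z].
Proof. exact: linearD. Qed.

Lemma lieZr a X Y : [lie X, a *: Y] = a *: [lie X, Y].
Proof. exact: linearZ. Qed.

Lemma lieNr X Y : [lie X, - Y] = - [lie X, Y].
Proof. exact: linearN. Qed.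

Lemma lie0r X : [lie X, 0] = 0.
Proof. exact: linear0. Qed.

Lemma lie0l X : [lie 0, X] = 0.
Proof. by rewrite lieC lie0r oppr0. Qed.

Lemma adE X Y : ad X Y = [lie X, Y].
Proof. by rewrite lfunE. Qed.

Lemma lie_derivation X Y Z :
  [lie X, [lie Y, Z]] = [lie [lie X, Y], Z] + [lie Y, [lie X, Z]].
Proof.
move/eqP: (lie_bracket_jacobi X Y Z); rewrite -addrA addr_eq0 => /eqP ->.
by rewrite opprD addrC [[lie Z, _]]lieC opprK [[lie Z, X]]lieC lieNr opprK.
Qed.

Lemma eq_linear_forms X Y : (forall u : {scalar L}, u X = u Y) -> X = Y.
Proof.
move=> eqXY; rewrite (coord_vbasis (memvf X)) (coord_vbasis (memvf Y)).
by apply: eq_bigr => i _; rewrite eqXY.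
Qed.

(* [field] only applies to scalars, so vector identities are tested against
   linear forms. *)
Ltac module_field :=
  let u := fresh "u" in apply: eq_linear_forms => u;
  rewrite ?(linearD u, linearN u, scalarZ u, linear0 u) /=; field.

(** * Exponentials of derivations with vanishing cube *)

Hypotheses (two_neq0 : 2%:R != 0 :> F) (three_neq0 : 3%:R != 0 :> F).

(** The sum defining [lfun_exp] stops at degree [\dim {:L}]; the bound on the dimension ensures that
    it reaches the quadratic term. *)
Lemma lfun_expE (D : 'End(L)) X :
  (1 < \dim {:L})%N -> D (D (D X)) = 0 ->
  lfun_exp D X = X + D X + 2%:R^-1 *: D (D X).
Proof.
rewrite /lfun_exp sum_lfunE; case: (\dim _) => [|[|n]] // _ D3.
have iterE k : iter k (fun g => (D \o g)%VF) \1%VF X = iter k D X.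
  by elim: k => [|k IH]; rewrite /= ?id_lfunE // comp_lfunE IH.
under eq_bigr => k _ do rewrite scale_lfunE iterE.
rewrite !big_ord_recl big1 => [|k _]; last first.
  suff -> : iter k.+3 D X = 0 by rewrite scaler0.
  by elim: (val k) => //= m ->; rewrite linear0.
by rewrite /= !invr1 !scale1r addr0 addrA.
Qed.

(** By the Leibniz rule the two sides differ only by the terms of degree 3 and 4 in [D] on the
    right, which [D21] and [D22] cancel. *)
Lemma lfun_exp_lie (D : 'End(L)) X Y :
  (1 < \dim {:L})%N -> (forall Z, D (D (D Z)) = 0) ->
  (forall Z W, D [lie Z, W] = [lie D Z, W] + [lie Z, D W]) ->
  lfun_exp D [lie X, Y] = [lie lfun_exp D X, lfun_exp D Y].
Proof.
move=> dimL D3 Dlie; rewrite !lfun_expE //.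
(* Leibniz expands the third power of [D] on [[lie X, Y]], which is zero, to three times the sum of
   the two mixed brackets. *)
have D21 : [lie D (D X), D Y] = - [lie D X, D (D Y)].
  apply: (scalerI three_neq0); apply/eqP; rewrite -subr_eq0 -(D3 [lie X, Y]).
  rewrite !Dlie !linearD /= !Dlie !linearD /= !Dlie !D3 !linear0 !lie0l.
  by apply/eqP; module_field.
(* Applying [D] to [D21] gives twice this bracket equal to zero. *)
have D22 : [lie D (D X), D (D Y)] = 0.
  apply: (scalerI two_neq0); rewrite scaler0.
  have /eqP := congr1 D D21.
  rewrite linearN -addr_eq0 /= !(Dlie, D3) lie0l linear0.
  by rewrite add0r addr0 scaler_nat mulr2n => /eqP.
rewrite !Dlie linearD /= !Dlie !(lieDl, lieDr, lieZl, lieZr) D21 D22.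
by module_field.
Qed.

(** * Eigenspaces of [ad H0] and the relations between [e] and [f] *)

Lemma mem_eigen_ad H a X :
  (X \in passmx.leigenspace (ad H) a) = ([lie H, X] == a *: X).
Proof.
by rewrite memv_ker add_lfunE opp_lfunE scale_lfunE id_lfunE adE subr_eq0.
Qed.

Lemma lie_eigen {H X Y a b} :
  [lie H, X] = a *: X -> [lie H, Y] = b *: Y ->
  [lie H, [lie X, Y]] = (a + b) *: [lie X, Y].
Proof. by move=> HX HY; rewrite lie_derivation HX HY lieZl lieZr scalerDl. Qed.

Section Graded.
Context {H0 Ip Im : L}.
Hypothesis gr_sum : (gr_minus H0 + gr_zero H0 + gr_plus H0)%VS = fullv.
Hypotheses (Ip_plus : Ip \in gr_plus H0) (Im_minus : Im \in gr_minus H0).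
Hypotheses (Ip_neq0 : Ip != 0) (lie_ImIp : [lie Im, Ip] = H0).

Local Notation e X := [lie Ip, X].
Local Notation f X := [lie Im, X].
Local Notation Vm := (gr_minus H0).
Local Notation g := (gr_zero H0).
Local Notation Vp := (gr_plus H0).
Local Notation E := (lfun_exp (ad Ip)).
Local Notation M := (lfun_exp (ad Im)).
Local Notation s := (E \o (M \o E))%VF.

Lemma gr_minusP X : reflect ([lie H0, X] = - 2%:R *: X) (X \in Vm).
Proof. by rewrite mem_eigen_ad; apply: eqP. Qed.

Lemma gr_zeroP X : reflect ([lie H0, X] = 0) (X \in g).
Proof. by rewrite mem_eigen_ad scale0r; apply: eqP. Qed.

Lemma gr_plusP X : reflect ([lie H0, X] = 2%:R *: X) (X \in Vp).
Proof. by rewrite mem_eigen_ad; apply: eqP. Qed.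

Lemma gr_decomp X : exists a b c,
  [/\ a \in Vm, b \in g, c \in Vp & X = a + b + c].
Proof.
have: X \in (Vm + g + Vp)%VS by rewrite gr_sum memvf.
case/memv_addP => _ /memv_addP[a am [b bg ->]] [c cp ->].
by exists a, b, c.
Qed.

(* (ad H0)^3 = 4 ad H0, so the eigenvalues c of ad H0 satisfy c^3 = 4c. *)
Lemma gr_eigen_eq0 {a X} :
  [lie H0, X] = a *: X -> a ^+ 3 != 4%:R * a -> X = 0.
Proof.
move=> HX a_neq; apply/eqP; move: (a_neq); rewrite -subr_eq0 => nz.
have cubic Y : [lie H0, [lie H0, [lie H0, Y]]] = 4%:R *: [lie H0, Y].
  have [x [y [z [/gr_minusP Hx /gr_zeroP Hy /gr_plusP Hz ->]]]] := gr_decomp Y.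
  rewrite !(lieDr, Hx, Hy, Hz, lieZr, lie0r); by module_field.
have /eqP := cubic X; rewrite !(HX, lieZr) -subr_eq0.
rewrite (_ : _ - _ = (a ^+ 3 - 4%:R * a) *: X); last by module_field.
by rewrite scaler_eq0 (negPf nz).
Qed.

Lemma four_neq0 : (4%:R : F) ^+ 3 != 4%:R * 4%:R.
Proof.
have -> : 4%:R = 2%:R * 2%:R :> F by rewrite -natrM.
rewrite -subr_eq0 (_ : _ - _ = 3%:R * 2%:R ^+ 4); last by ring.
by rewrite mulf_neq0 // expf_neq0.
Qed.

Lemma eigen4_eq0 {X} : [lie H0, X] = 4%:R *: X -> X = 0.
Proof. by move/gr_eigen_eq0; apply; apply: four_neq0. Qed.

Lemma eigenN4_eq0 {X} : [lie H0, X] = - 4%:R *: X -> X = 0.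
Proof.
move/gr_eigen_eq0; apply.
rewrite -subr_eq0 (_ : _ - _ = - (4%:R ^+ 3 - 4%:R * 4%:R)); last by ring.
by rewrite oppr_eq0 subr_eq0 four_neq0.
Qed.

Lemma e_minus {X} : X \in Vm -> e X \in g.
Proof.
move=> /gr_minusP HX; apply/gr_zeroP.
by rewrite (lie_eigen (gr_plusP _ Ip_plus) HX) subrr scale0r.
Qed.

Lemma e_zero {X} : X \in g -> e X \in Vp.
Proof.
move=> /gr_zeroP HX; apply/gr_plusP.
by rewrite lie_derivation HX lie0r addr0 (gr_plusP _ Ip_plus) lieZl.
Qed.

Lemma e_plus {X} : X \in Vp -> e X = 0.
Proof.
move=> /gr_plusP HX; apply: eigen4_eq0.
by rewrite (lie_eigen (gr_plusP _ Ip_plus) HX) -natrD.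
Qed.

Lemma f_plus {X} : X \in Vp -> f X \in g.
Proof.
move=> /gr_plusP HX; apply/gr_zeroP.
by rewrite (lie_eigen (gr_minusP _ Im_minus) HX) addNr scale0r.
Qed.

Lemma f_zero {X} : X \in g -> f X \in Vm.
Proof.
move=> /gr_zeroP HX; apply/gr_minusP.
by rewrite lie_derivation HX lie0r addr0 (gr_minusP _ Im_minus) lieZl.
Qed.

Lemma f_minus {X} : X \in Vm -> f X = 0.
Proof.
move=> /gr_minusP HX; apply: eigenN4_eq0.
by rewrite (lie_eigen (gr_minusP _ Im_minus) HX) -opprD -natrD.
Qed.

Lemma ef_comm X : e (f X) = f (e X) - [lie H0, X].
Proof. by rewrite [f (e X)]lie_derivation lie_ImIp addrAC subrr add0r. Qed.

Lemma ef_plus {X} : X \in Vp -> e (f X) = - 2%:R *: X.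
Proof.
move=> Xp; rewrite ef_comm (e_plus Xp) lie0r sub0r (gr_plusP _ Xp).
by rewrite scaleNr.
Qed.

Lemma ef_zero {X} : X \in g -> e (f X) = f (e X).
Proof. by move=> /gr_zeroP HX; rewrite ef_comm HX subr0. Qed.

Lemma fe_minus {X} : X \in Vm -> f (e X) = - 2%:R *: X.
Proof.
move=> Xm; rewrite -[LHS](subrK [lie H0, X]) -ef_comm (f_minus Xm) lie0r add0r.
exact/gr_minusP.
Qed.

Lemma e3 X : e (e (e X)) = 0.
Proof.
have [x [y [z [xm yg zp ->]]]] := gr_decomp X.
by rewrite !lieDr (e_plus zp) (e_plus (e_zero yg))
  (e_plus (e_zero (e_minus xm))) !lie0r !addr0.
Qed.

Lemma f3 X : f (f (f X)) = 0.
Proof.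
have [x [y [z [xm yg zp ->]]]] := gr_decomp X.
by rewrite !lieDr (f_minus xm) (f_minus (f_zero yg))
  (f_minus (f_zero (f_plus zp))) !lie0r !addr0.
Qed.

(** [H0] and [Ip] are independent: a multiple of [Ip] would commute with [Ip], whereas [H0] acts on
    it by 2. *)
Lemma dim_gt1 : (1 < \dim {:L})%N.
Proof.
have frHI : free [:: H0; Ip].
  rewrite free_cons seq1_free Ip_neq0 andbT span_seq1.
  apply/negP => /vlineP[k Hk].
  have := gr_plusP _ Ip_plus.
  rewrite {1}Hk lieZl lie_bracket_alternating scaler0.
  by move/esym/eqP; rewrite scaler_eq0 (negPf two_neq0) (negPf Ip_neq0).
by rewrite -[2%N]/(size [:: H0; Ip]) -(eqnP frHI) dimvS ?subvf.
Qed.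

(** * Closed formulas for [s] on the graded pieces *)

Lemma expeE X : E X = X + e X + 2%:R^-1 *: e (e X).
Proof. by rewrite lfun_expE ?dim_gt1 // !adE ?e3. Qed.

Lemma expfE X : M X = X + f X + 2%:R^-1 *: f (f X).
Proof. by rewrite lfun_expE ?dim_gt1 // !adE ?f3. Qed.

(** The first [E] fixes [X]. After the last one, the terms in [Vp] add up to X - 2X + X and those in
    [g] to fX - fX, so only the term in [Vm] survives. *)
Lemma weyl_plus {X} : X \in Vp -> s X = 2%:R^-1 *: f (f X).
Proof.
move=> Xp; rewrite !comp_lfunE !expeE !expfE (e_plus Xp) !lie0r.
have fXg := f_plus Xp; have ffXm := f_zero fXg.
rewrite !(lieDr, lieZr, lie0r, f3) (ef_zero fXg) (ef_plus Xp) (e_plus Xp).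
rewrite !(lieDr, lieZr, lie0r, ef_plus Xp, e_plus Xp).
by module_field.
Qed.

(** The same cancellation already takes place after [M]; the last [E] fixes the remaining term
    because the cube of [e] is zero. *)
Lemma weyl_minus {X} : X \in Vm -> s X = 2%:R^-1 *: e (e X).
Proof.
move=> Xm; rewrite !comp_lfunE !expeE !expfE.
have eXg := e_minus Xm; have eeXp := e_zero eXg.
rewrite !(lieDr, lieZr, lie0r, f_minus Xm, fe_minus Xm) -(ef_zero eXg).
rewrite !(fe_minus Xm, lieDr, lieZr, lie0r, f_minus Xm, e3).
by module_field.
Qed.

Lemma efe_zero {X} : X \in g -> e (f (e X)) = - 2%:R *: e X.
Proof. by move=> Xg; rewrite ef_plus ?e_zero. Qed.

Lemma ffe_zero {X} : X \in g -> f (f (e X)) = - 2%:R *: f X.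
Proof. by move=> Xg; rewrite -ef_zero // fe_minus ?f_zero. Qed.

(** Under [M], the term fX cancels against half of ffeX = -2fX; under the last [E], 2eX cancels
    against efeX. *)
Lemma weyl_zero {X} : X \in g -> s X = X + f (e X).
Proof.
move=> Xg; rewrite !comp_lfunE !expeE !expfE.
have eeX : e (e X) = 0 by rewrite e_plus ?e_zero.
have ffX : f (f X) = 0 by rewrite f_minus ?f_zero.
rewrite !(lieDr, lieZr, lie0r, eeX, ffX, ffe_zero Xg, efe_zero Xg, ef_zero Xg).
by module_field.
Qed.

(** * The involutive automorphism [s] and its action on the grading *)

Lemma weylK : (s \o s = \1)%VF.
Proof.
apply/lfunP => X; rewrite comp_lfunE id_lfunE.
have [x [y [z [xm yg zp ->]]]] := gr_decomp X.
have ffzm : f (f z) \in Vm by rewrite !(f_zero, f_plus).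
have eexp : e (e x) \in Vp by rewrite !(e_zero, e_minus).
have feyg : f (e y) \in g by rewrite f_plus ?e_zero.
have sxyz : s (x + y + z) =
    2%:R^-1 *: e (e x) + (y + f (e y)) + 2%:R^-1 *: f (f z).
  by rewrite !linearD /= weyl_minus // weyl_zero // weyl_plus.
(* On [g], (1 + fe)^2 = 1 because fefe = -2fe. On [Vp] and [Vm], eeff and ffee act as 4, which
   offsets the two factors 1/2. *)
rewrite sxyz !linearD !linearZ /= (weyl_plus eexp) (weyl_minus ffzm).
rewrite (weyl_zero yg) (weyl_zero feyg) (efe_zero yg) lieZr.
rewrite (ef_zero (f_plus zp)) (ef_plus zp) -(ef_zero (e_minus xm)).
rewrite (fe_minus xm) !lieZr (fe_minus xm) (ef_plus zp).
by module_field.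
Qed.

Lemma weyl_lie X Y : s [lie X, Y] = [lie s X, s Y].
Proof.
have expP Z : (forall W, [lie Z, [lie Z, [lie Z, W]]] = 0) ->
    forall W W', lfun_exp (ad Z) [lie W, W'] =
      [lie lfun_exp (ad Z) W, lfun_exp (ad Z) W'].
  move=> Z3 W W'; apply: lfun_exp_lie => [|V|V V']; first exact: dim_gt1.
    by rewrite !adE Z3.
  by rewrite !adE lie_derivation.
by rewrite !comp_lfunE !(expP _ e3, expP _ f3).
Qed.

Lemma weyl_H0 : s H0 = - H0.
Proof.
have H0g : H0 \in g by apply/gr_zeroP; rewrite lie_bracket_alternating.
rewrite weyl_zero // [e H0]lieC (gr_plusP _ Ip_plus) lieNr lieZr lie_ImIp.
by module_field.
Qed.

Lemma weyl_Ip : s Ip = Im.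
Proof.
by rewrite weyl_plus // lie_ImIp lieC (gr_minusP _ Im_minus); module_field.
Qed.

Lemma H0_neq0 : H0 != 0.
Proof.
apply: contra_neq Ip_neq0 => H00; have := gr_plusP _ Ip_plus.
rewrite H00 lie0l => /esym/eqP; rewrite scaler_eq0 (negPf two_neq0).
by move/eqP.
Qed.

Lemma weyl_involution : lie_involution s.
Proof.
have sK : cancel s s by move=> X; rewrite -[s (s X)]comp_lfunE weylK id_lfunE.
split; [split; [by exists s | exact: weyl_lie] | exact: weylK |].
(* [s] is not the identity, since it negates the nonzero vector [H0] and 2 is invertible. *)
move=> s1; have := weyl_H0; rewrite s1 id_lfunE => /eqP.
rewrite -addr_eq0 -mulr2n -scaler_nat scaler_eq0 (negPf two_neq0).
by rewrite (negPf H0_neq0).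
Qed.

Lemma involution_img (t : 'End(L)) (U W : {vspace L}) :
  (t \o t = \1)%VF -> (forall X, X \in U -> t X \in W) ->
  (forall X, X \in W -> t X \in U) -> (t @: U)%VS = W.
Proof.
move=> tK UW WU; apply/eqP; rewrite eqEsubv; apply/andP; split.
  by apply/subvP => _ /memv_imgP[X XU ->]; apply: UW.
apply/subvP => X XW; rewrite -[X]id_lfunE -tK comp_lfunE.
by rewrite memv_img ?WU.
Qed.

Lemma weyl_img_plus : (s @: Vp)%VS = Vm.
Proof.
apply: involution_img weylK _ _ => X XV.
  by rewrite weyl_plus // memvZ ?f_zero ?f_plus.
by rewrite weyl_minus // memvZ ?e_zero ?e_minus.
Qed.

Lemma weyl_img_zero : (s @: g)%VS = g.
Proof.
by apply: involution_img weylK _ _ => X Xg;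
  rewrite weyl_zero // memvD ?f_plus ?e_zero.
Qed.

(** * Fixed and anti-fixed subspaces of [g] *)

Lemma mem_eigen_weyl a X : X \in g ->
  (X \in passmx.leigenspace s a) = (X + f (e X) == a *: X).
Proof.
move=> Xg; rewrite memv_ker add_lfunE opp_lfunE scale_lfunE id_lfunE subr_eq0.
by rewrite weyl_zero.
Qed.

Lemma mem_centralizer U X Y :
  (Y \in centralizer U X) = (Y \in U) && ([lie X, Y] == 0).
Proof. by rewrite memv_cap memv_ker adE. Qed.

Lemma scale_neg2_eq0 X : - 2%:R *: X = 0 -> X = 0.
Proof. by move/eqP; rewrite scaler_eq0 oppr_eq0 (negPf two_neq0) => /eqP. Qed.

Lemma fixed_weyl_plus : (g :&: passmx.leigenspace s 1)%VS = centralizer g Ip.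
Proof.
apply/vspaceP => X; rewrite memv_cap mem_centralizer.
case Xg: (X \in g) => //=.
rewrite mem_eigen_weyl // scale1r -subr_eq0 addrAC subrr add0r.
apply/eqP/eqP => [feX|->]; last by rewrite lie0r.
by apply: scale_neg2_eq0; rewrite -efe_zero // feX lie0r.
Qed.

Lemma fixed_weyl_minus : (g :&: passmx.leigenspace s 1)%VS = centralizer g Im.
Proof.
rewrite fixed_weyl_plus; apply/vspaceP => X; rewrite !mem_centralizer.
case Xg: (X \in g) => //=; apply/eqP/eqP => [eX|fX]; apply: scale_neg2_eq0.
  by rewrite -ffe_zero // eX !lie0r.
(* Since [e] and [f] commute on [g], -2eX = efeX = eefX. *)
by rewrite -efe_zero // -ef_zero // fX !lie0r.
Qed.

Lemma mem_antifixed_weyl X :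
  X \in (g :&: passmx.leigenspace s (- 1))%VS ->
  X \in g /\ f (e X) = - 2%:R *: X.
Proof.
rewrite memv_cap => /andP[Xg]; rewrite mem_eigen_weyl // => /eqP sX.
by split=> //; rewrite -[LHS](addKr X) sX; module_field.
Qed.

Lemma antifixed_iso_plus :
  iso_onto (ad Ip) (g :&: passmx.leigenspace s (- 1))%VS Vp.
Proof.
split.
  move=> X Y /mem_antifixed_weyl[_ fX] /mem_antifixed_weyl[_ fY].
  rewrite !adE => eXY; apply: (scalerI (_ : - 2%:R != 0 :> F)).
    by rewrite oppr_eq0.
  by rewrite -fX eXY.
apply/eqP; rewrite eqEsubv; apply/andP; split; apply/subvP => X.
  by case/memv_imgP => Y /mem_antifixed_weyl[Yg _] ->; rewrite adE e_zero.
move=> Xp; apply/memv_imgP; exists (- 2%:R^-1 *: f X); last first.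
  by rewrite adE lieZr ef_plus //; module_field.
(* The witness is anti-fixed because fefX = -2fX. *)
have fXg := f_plus Xp; rewrite memv_cap memvZ //= mem_eigen_weyl ?memvZ //.
by rewrite !lieZr ef_plus // lieZr; apply/eqP; module_field.
Qed.

Lemma antifixed_iso_minus :
  iso_onto (ad Im) (g :&: passmx.leigenspace s (- 1))%VS Vm.
Proof.
split.
  move=> X Y /mem_antifixed_weyl[Xg fX] /mem_antifixed_weyl[Yg fY].
  rewrite !adE => fXY; apply: (scalerI (_ : - 2%:R != 0 :> F)).
    by rewrite oppr_eq0.
  (* Commuting [e] past [f] gives -2X = efX, so fX determines X. *)
  by rewrite -fX -fY -!ef_zero // fXY.
apply/eqP; rewrite eqEsubv; apply/andP; split; apply/subvP => X.
  by case/memv_imgP => Y /mem_antifixed_weyl[Yg _] ->; rewrite adE f_zero.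
move=> Xm; apply/memv_imgP; exists (- 2%:R^-1 *: e X); last first.
  by rewrite adE lieZr fe_minus //; module_field.
have eXg := e_minus Xm; rewrite memv_cap memvZ //= mem_eigen_weyl ?memvZ //.
by rewrite !lieZr -ef_zero // fe_minus // lieZr; apply/eqP; module_field.
Qed.

End Graded.
End LieAlgebras.

Theorem theorem4p1p1 (p : nat) (p_pr : prime p) (F : fieldExtType (Qp p_pr))
  (res_char : ~ residue_pchar F 2)
  (Fbar : closedFieldType) (iota : {rmorphism F -> Fbar})
  (Fbar_closure : algebraic_closure iota)
  (L : lieAlgType F) (H0 : L) (L_graded : regular_graded H0 iota)
  (Ip Im : L) (Ip_generic : generic H0 Ip) (Im_minus : Im \in gr_minus H0)
  (triple : sl2_triple Im H0 Ip) :
  let Vm := gr_minus H0 in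
  let g := gr_zero H0 in
  let Vp := gr_plus H0 in
  let s : 'End(L) :=
    (lfun_exp (ad Ip) \o (lfun_exp (ad Im) \o lfun_exp (ad Ip)))%VF in
  let h := (g :&: passmx.leigenspace s 1)%VS in
  let q := (g :&: passmx.leigenspace s (- 1))%VS in
  lie_involution s /\
  [/\ h = centralizer g Ip /\ h = centralizer g Im,
      iso_onto (ad Ip) q Vp /\ iso_onto (ad Im) q Vm,
      [/\ s Ip = Im, (s @: Vp)%VS = Vm,
          forall X, X \in Vp -> s X = (2%:R : F)^-1 *: [lie Im, [lie Im, X]]
        & forall X, X \in Vm -> s X = (2%:R : F)^-1 *: [lie Ip, [lie Ip, X]]]
    & [/\ s H0 = - H0, (s @: g)%VS = g
        & forall X, X \in g -> s X = X + [lie Im, [lie Ip, X]]]].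
Proof.
move=> Vm g Vp s h q.
have two_neq0 : 2%:R != 0 :> F by rewrite padic_ext_natr_eq0.
have three_neq0 : 3%:R != 0 :> F by rewrite padic_ext_natr_eq0.
case: Ip_generic => Ip_plus eg; case: triple => _ _ ImIp.
have sumL := rg_sum L_graded.
(* If [Ip] were zero, the image of [ad Ip] would vanish, yet by genericity it is the nonzero space
   [Vp]. *)
have Ip_neq0 : Ip != 0.
  apply: contraNneq (rg_plus_neq0 L_graded) => Ip0; rewrite -eg Ip0.
  rewrite -subv0; apply/subvP => _ /memv_imgP[X _ ->].
  by rewrite adE lie0l mem0v.
split; first exact: (weyl_involution two_neq0 three_neq0 (H0 := H0)).
split.
- by split; [apply: fixed_weyl_plus | apply: fixed_weyl_minus].
- by split; [apply: antifixed_iso_plus | apply: antifixed_iso_minus].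
- split; [exact: (weyl_Ip two_neq0 three_neq0 (H0 := H0))
         | exact: weyl_img_plus | |] => X XV.
    exact: (weyl_plus two_neq0 three_neq0 (H0 := H0)).
  exact: (weyl_minus two_neq0 three_neq0 (H0 := H0)).
- split; [exact: weyl_H0 | exact: weyl_img_zero |] => X Xg.
  exact: (weyl_zero two_neq0 three_neq0 (H0 := H0)).
Qed.
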